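(* Let $A$ be a Banach algebra with product $\pi:A\times A\to A$, $\pi(a,b)=ab$, and let $\Omega:A\times A\times A\to A$ be a bounded tri-linear mapping. (1) If $A$ has a bounded right approximate identity and, for every $a^{**}\in A^{**}$, the bounded linear map $T:A^{*}\to A^{*}$ given by $T(a^{*})=\pi^{**}(a^{**},a^{*})$ is weakly compact, then $\Omega$ is regular. (2) If $A$ has a bounded left approximate identity and, for every $a^{**}\in A^{**}$, the bounded linear map $T:A\to A^{**}$ given by $T(a)=\pi^{r*r*}(a^{**},a)$ is weakly compact, then $\Omega$ is regular.
   Context: Normed spaces are identified with their canonical images in their biduals. Adjoints of bilinear maps: for a bounded bilinear $m:X\times Y\to Z$, $m^{*}:Z^{*}\times X\to Y^{*}$ is given by $\langle m^{*}(z^{*},x),y\rangle=\langle z^{*},m(x,y)\rangle$; $m^{**}=(m^{*})^{*}:Y^{**}\times Z^{*}\to X^{*}$. The flip is $m^{r}(y,x)=m(x,y)$. A superscript string is applied from left to right, so $\pi^{r*r*}=(((\pi^{r})^{*})^{r})^{*}:A^{**}\times A\to A^{**}$. Adjoints of tri-linear maps: for a bounded tri-linear $f:X\times Y\times Z\to W$, $f^{*}:W^{*}\times X\times Y\to Z^{*}$ is given by $\langle f^{*}(w^{*},x,y),z\rangle=\langle w^{*},f(x,y,z)\rangle$; iterating, $f^{**}=(f^{*})^{*}:Z^{**}\times W^{*}\times X\to Y^{*}$, $f^{***}=(f^{**})^{*}:Y^{**}\times Z^{**}\times W^{*}\to X^{*}$, $f^{****}=(f^{***})^{*}:X^{**}\times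 Y^{**}\times Z^{**}\to W^{**}$. The flip is $f^{r}(z,y,x)=f(x,y,z)$, and $f^{r****r}=((f^{r})^{****})^{r}$. The map $f$ is regular if $f^{****}=f^{r****r}$. *)

(* Defs.v *)
From HB Require Import structures.
From mathcomp Require Import all_boot all_order all_algebra.
From mathcomp Require Import all_classical all_reals all_analysis.
From mathcomp Require Import complex.

Set Implicit Arguments.
Unset Strict Implicit.
Unset Printing Implicit Defensive.

Import Order.TTheory GRing.Theory Num.Theory.
Import numFieldNormedType.Exports.

Local Open Scope classical_set_scope.
Local Open Scope ring_scope.

Variant scalars := RealScalars of realType | ComplexScalars of realType.

Definition scalar_field (K : scalars) : numFieldType :=
  match K with
  | RealScalars R => R
  | ComplexScalars R => R[i]
  end.
Coercion scalar_field : scalars >-> numFieldType.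

(* Norms are K-valued, so the operator norm needs suprema of bounded sets of
   nonnegative elements of K, also when K = R[i] with its partial order. *)
Lemma supremums_nneg (K : scalars) (A : set K) : A !=set0 ->
  (forall x, A x -> 0 <= x) -> has_ubound A -> supremums A !=set0.
Proof.
case: K A => R /= A A0 Age0 [M AM].
  exists (sup A); split; first by apply: sup_upper_bound; split => //; exists M.
  by move=> y Ay; apply: ge_sup.
have ImA x : A x -> x = (complex.Re x)%:C%C.
  by case: x => a b /Age0; rewrite lecE/= => /andP[/eqP -> _].
have ubRe y : ubound A y -> ubound [set complex.Re x | x in A] (complex.Re y).
  by move=> Ay _ [x Ax <-]; move/(_ _ Ax): Ay; rewrite lecE => /andP[].
have hsA : has_sup [set complex.Re x | x in A].
  split; first by case: A0 => x Ax; exists (complex.Re x), x.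
  by exists (complex.Re M); exact: ubRe.
exists ((sup [set complex.Re x | x in A])%:C)%C; split.
  move=> x Ax; rewrite (ImA _ Ax) lecR.
  by apply: sup_upper_bound => //; exists x.
move=> y Ay; case: A0 => x Ax.
have := Ay _ Ax; rewrite {1}(ImA _ Ax) !lecE /= => /andP[-> _] /=.
by apply: ge_sup; [exact: hsA.1 | exact: ubRe].
Qed.

Section Dual.
Context {K : scalars}.
Implicit Types X Y : normedModType K.

Definition bounded_linear X Y (f : X -> Y) :=
  linear f /\ exists C : K, forall x, `|f x| <= C * `|x|.

Lemma linear_fun0 X Y (f : X -> Y) : linear f -> f 0 = 0.
Proof.
by move=> lf; have := lf (-1) 0 0; rewrite scaler0 addr0 scaleN1r addNr.
Qed.

Definition bounded_linearb X (f : X -> K^o) : bool := `[< bounded_linear f >].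

Record dual X := Dual {
  dual_fun :> X -> K^o;
  dualP : bounded_linearb dual_fun }.

HB.instance Definition _ X := [isSub for @dual_fun X].
HB.instance Definition _ X := [Choice of dual X by <:].

Fact bounded_linear_submod X : submod_closed (@bounded_linearb X).
Proof.
have bl0 : bounded_linear (0 : X -> K^o).
  split=> [b x y|]; first by rewrite /= scaler0 addr0.
  by exists 0 => x; rewrite normr0 mul0r.
have blD a (f g : X -> K^o) : bounded_linear f -> bounded_linear g ->
    bounded_linear (a *: f + g).
  move=> [lf [C fC]] [lg [D gD]]; split=> [b x y|].
    rewrite !fctE lf lg !scalerDr addrACA !scalerA.
    by rewrite (mulrC a b).
  exists (`|a| * C + D) => x; rewrite !fctE mulrDl.
  rewrite (le_trans (ler_normD _ _))// lerD//.
  by rewrite normrZ -mulrA ler_wpM2l.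
split=> [|a f g]; first exact/asboolP.
by move=> fb gb; apply/asboolP; apply: blD; apply/asboolP; [exact: fb|exact: gb].
Qed.

HB.instance Definition _ X := GRing.isSubmodClosed.Build K (X -> K^o)
  (@bounded_linearb X) (bounded_linear_submod X).
HB.instance Definition _ X := [SubChoice_isSubLmodule of dual X by <:].

Lemma dual_linear X (f : dual X) : linear f.
Proof. by have /asboolP[] := dualP f. Qed.

Definition opnorm X (f : dual X) : K :=
  supremum 0 [set `|f x| | x in [set x : X | `|x| <= 1]].

Lemma dual_bound X (f : dual X) :
  exists2 C : K, 0 <= C & forall x, `|f x| <= C * `|x|.
Proof.
have /asboolP[lf [C fC]] := dualP f; exists `|C| => // x.
have [->|x0] := eqVneq x 0.
  by rewrite (linear_fun0 lf) !normr0 mulr0.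
rewrite (le_trans (fC x))// ger0_norm//.
have : 0 <= C * `|x| by rewrite (le_trans _ (fC x)).
by rewrite pmulr_lge0// normr_gt0.
Qed.

Lemma dual0 X (f : dual X) : f 0 = 0.
Proof. exact: linear_fun0 (dual_linear f). Qed.

Lemma dualZ X (f : dual X) a x : f (a *: x) = a * f x.
Proof. by have := dual_linear f a x 0; rewrite !addr0 dual0 addr0. Qed.

Lemma opnorm_supremums X (f : dual X) :
  supremums [set `|f x| | x in [set x : X | `|x| <= 1]] (opnorm f).
Proof.
rewrite /opnorm /supremum; set A := [set _ | _ in _].
have A0 : A !=set0 by exists `|f 0|, 0 => //=; rewrite normr0.
rewrite ifF; last by apply/negP => /eqP A_eq0; case: A0; rewrite A_eq0.
apply: (@xgetPex _ _ (supremums A)); apply: supremums_nneg => //.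
  by move=> _ [x _ <-].
have [C C0 fC] := dual_bound f.
exists C => _ [x /= x1 <-]; rewrite (le_trans (fC x))//.
by rewrite ler_piMr.
Qed.

Lemma opnorm_ge0 X (f : dual X) : 0 <= opnorm f.
Proof.
have [+ _] := opnorm_supremums f.
by apply; exists 0; rewrite /= ?normr0// dual0 normr0.
Qed.

Lemma opnormP X (f : dual X) x : `|f x| <= opnorm f * `|x|.
Proof.
have [->|x0] := eqVneq x 0; first by rewrite dual0 !normr0 mulr0.
have [+ _] := opnorm_supremums f.
rewrite -ler_pdivrMr ?normr_gt0//; apply; exists (`|x|^-1 *: x).
  by rewrite /= normrZ normfV normr_id mulVf// normr_eq0.
by rewrite dualZ normrM normfV normr_id mulrC.
Qed.

Lemma opnorm_le X (f : dual X) (C : K) : 0 <= C ->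
  (forall x, `|f x| <= C * `|x|) -> opnorm f <= C.
Proof.
move=> C0 fC; have [_ +] := opnorm_supremums f; apply.
by move=> _ [x /= x1 <-]; rewrite (le_trans (fC x))// ler_piMr.
Qed.

Lemma dualDE X (f g : dual X) x : (f + g) x = f x + g x.
Proof. by []. Qed.

Lemma dualZE X (a : K) (f : dual X) x : (a *: f) x = a * f x.
Proof. by []. Qed.

Lemma dual_ext X (f g : dual X) : (forall x, f x = g x) -> f = g.
Proof. by move=> fg; apply/val_inj/funext. Qed.

Let opnormD X (f g : dual X) : opnorm (f + g) <= opnorm f + opnorm g.
Proof.
apply: opnorm_le => [|x]; first by rewrite addr_ge0// opnorm_ge0.
rewrite dualDE mulrDl (le_trans (ler_normD _ _))//.
by rewrite lerD// opnormP.
Qed.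

Let opnormZ_le X (a : K) (f : dual X) : opnorm (a *: f) <= `|a| * opnorm f.
Proof.
apply: opnorm_le => [|x]; first by rewrite mulr_ge0// opnorm_ge0.
by rewrite dualZE normrM -mulrA ler_wpM2l// opnormP.
Qed.

Let opnormZ X (a : K) (f : dual X) : opnorm (a *: f) = `|a| * opnorm f.
Proof.
apply/le_anti/andP; split; first exact: opnormZ_le.
have [->|a0] := eqVneq a 0; first by rewrite normr0 mul0r opnorm_ge0.
rewrite -ler_pdivlMl ?normr_gt0// -normfV.
have {1}-> : f = a^-1 *: (a *: f) by rewrite scalerA mulVf// scale1r.
exact: opnormZ_le.
Qed.

Let opnorm_eq0 X (f : dual X) : opnorm f = 0 -> f = 0.
Proof.
move=> f0; apply: dual_ext => x; apply/eqP.
by rewrite -normr_le0 (le_trans (opnormP f x))// f0 mul0r.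
Qed.

HB.instance Definition _ X := Lmodule_isNormed.Build K (dual X)
  (@opnormD X) (@opnormZ X) (@opnorm_eq0 X).

Lemma normr_dualE X (f : dual X) :
  `|f| = supremum 0 [set `|f x| | x in [set x : X | `|x| <= 1]].
Proof. by []. Qed.

Lemma ler_dual X (f : dual X) x : `|f x| <= `|f| * `|x|.
Proof. exact: opnormP. Qed.

End Dual.

Notation bidual X := (dual (dual X)).

Section WeakTopology.
Context {K : scalars}.
Implicit Types X Y : normedModType K.

(* The weak topology on X is the initial topology for the family dual X. *)
Definition weak_eval X (x : X) : {ptws dual X -> K^o} := fun f => f x.

Definition weak X : Type := initial_topology (@weak_eval X).
HB.instance Definition _ X :=
  Topological.copy (weak X) (initial_topology (@weak_eval X)).

Lemma weak_cvgP X (F : set_system X) (x : X) : Filter F ->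
  (F --> (x : weak X)) <-> forall f : dual X, f y @[y --> F] --> f x.
Proof.
move=> FF; split=> [Fx f|Fx U].
  apply: (@cvg_comp _ _ _ (@weak_eval X) (fun g : {ptws dual X -> K^o} => g f)
    F (nbhs (weak_eval x))).
    move=> U /(@initial_continuous X _ (@weak_eval X) x); exact: Fx.
  exact: (@proj_continuous _ (fun=> K^o) f (weak_eval x)).
rewrite nbhsE => -[_ [[B oB <-] Bx] BU].
apply: (filterS BU).
suff : nbhs (@weak_eval X @ F) B by [].
have : @weak_eval X @ F --> weak_eval x; last first.
  by apply; exact: open_nbhs_nbhs.
apply/(@cvg_sup _ _ _ (@weak_eval X @ F) (weak_eval x)) => f V.
rewrite nbhsE => -[_ [[C oC <-] Cx] CV].
apply: (filterS CV); apply: (Fx f C); exact: open_nbhs_nbhs.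
Qed.

(* For T linear and bounded: T maps the unit ball to a relatively weakly compact
   set. *)
Definition weakly_compact X Y (T : X -> Y) :=
  compact (closure (T @` [set x | `|x| <= 1] : set (weak Y))).

End WeakTopology.

Section Multilinear.
Context {K : scalars}.
Implicit Types X Y Z W : normedModType K.

(* flip2 m and flip3 f are m^r and f^r, adj2 m and adj3 f are m^* and f^*. *)

Record bounded_bilinear X Y Z := BoundedBilinear {
  bilin_fun :> X -> Y -> Z;
  bilin_linear1 : forall y, linear (fun x => bilin_fun x y);
  bilin_linear2 : forall x, linear (fun y => bilin_fun x y);
  bilin_bounded : exists C : K,
    forall x y, `|bilin_fun x y| <= C * `|x| * `|y| }.

Record bounded_trilinear X Y Z W := BoundedTrilinear {
  trilin_fun :> X -> Y -> Z -> W;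
  trilin_linear1 : forall y z, linear (fun x => trilin_fun x y z);
  trilin_linear2 : forall x z, linear (fun y => trilin_fun x y z);
  trilin_linear3 : forall x y, linear (fun z => trilin_fun x y z);
  trilin_bounded : exists C : K,
    forall x y z, `|trilin_fun x y z| <= C * `|x| * `|y| * `|z| }.

Lemma bilin_bounded_ge0 X Y Z (m : bounded_bilinear X Y Z) :
  exists2 C : K, 0 <= C & forall x y, `|m x y| <= C * `|x| * `|y|.
Proof.
have [C mC] := bilin_bounded m; exists `|C| => // x y.
have [->|x0] := eqVneq x 0.
  by rewrite (linear_fun0 (bilin_linear1 m y)) !normr0 mulr0 mul0r.
have [->|y0] := eqVneq y 0.
  by rewrite (linear_fun0 (bilin_linear2 m x)) !normr0 mulr0.
rewrite (le_trans (mC x y))// ger0_norm//.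
have : 0 <= C * `|x| * `|y| by rewrite (le_trans _ (mC x y)).
by rewrite !pmulr_lge0 ?normr_gt0.
Qed.

Lemma trilin_bounded_ge0 X Y Z W (f : bounded_trilinear X Y Z W) :
  exists2 C : K, 0 <= C &
    forall x y z, `|f x y z| <= C * `|x| * `|y| * `|z|.
Proof.
have [C fC] := trilin_bounded f; exists `|C| => // x y z.
have [->|x0] := eqVneq x 0.
  by rewrite (linear_fun0 (trilin_linear1 f y z)) !normr0 mulr0 !mul0r.
have [->|y0] := eqVneq y 0.
  by rewrite (linear_fun0 (trilin_linear2 f x z)) !normr0 mulr0 mul0r.
have [->|z0] := eqVneq z 0.
  by rewrite (linear_fun0 (trilin_linear3 f x y)) !normr0 mulr0.
rewrite (le_trans (fC x y z))// ger0_norm//.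
have : 0 <= C * `|x| * `|y| * `|z| by rewrite (le_trans _ (fC x y z)).
by rewrite !pmulr_lge0 ?normr_gt0.
Qed.

Section Flip2.
Variables (X Y Z : normedModType K) (m : bounded_bilinear X Y Z).

Fact flip2_bounded : exists C : K, forall y x, `|m x y| <= C * `|y| * `|x|.
Proof. by have [C mC] := bilin_bounded m; exists C => y x; rewrite mulrAC. Qed.

Definition flip2 : bounded_bilinear Y X Z :=
  @BoundedBilinear Y X Z (fun y x => m x y)
    (bilin_linear2 m) (bilin_linear1 m) flip2_bounded.

End Flip2.

Section Adjoint2.
Variables (X Y Z : normedModType K) (m : bounded_bilinear X Y Z).

Fact adj2_dual (f : dual Z) (x : X) : bounded_linearb (fun y => f (m x y)).
Proof.
apply/asboolP; split=> [a y y'|]; first by rewrite bilin_linear2 dual_linear.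
have [C C0 mC] := bilin_bounded_ge0 m.
exists (`|f| * (C * `|x|)) => y.
by rewrite (le_trans (ler_dual _ _))// -mulrA ler_wpM2l.
Qed.

Definition adj2_fun (f : dual Z) (x : X) : dual Y := Dual (adj2_dual f x).

Fact adj2_linear1 x : linear (fun f => adj2_fun f x).
Proof. by move=> a f g; apply: dual_ext. Qed.

Fact adj2_linear2 f : linear (fun x => adj2_fun f x).
Proof.
move=> a x x'; apply: dual_ext => y /=.
by rewrite (bilin_linear1 m y) dual_linear.
Qed.

Fact adj2_bounded : exists C : K,
  forall f x, `|adj2_fun f x| <= C * `|f| * `|x|.
Proof.
have [C C0 mC] := bilin_bounded_ge0 m; exists C => f x.
apply: opnorm_le => [|y]; first by rewrite !mulr_ge0.
rewrite /= (le_trans (ler_dual _ _))// (mulrC C) -!mulrA ler_wpM2l//.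
by rewrite mulrA.
Qed.

Definition adj2 : bounded_bilinear (dual Z) X (dual Y) :=
  BoundedBilinear adj2_linear1 adj2_linear2 adj2_bounded.

Lemma adj2E f x y : adj2 f x y = f (m x y). Proof. by []. Qed.

End Adjoint2.

Section Flip3.
Variables (X Y Z W : normedModType K) (f : bounded_trilinear X Y Z W).

Fact flip3_bounded : exists C : K,
  forall z y x, `|f x y z| <= C * `|z| * `|y| * `|x|.
Proof.
have [C fC] := trilin_bounded f; exists C => z y x.
rewrite (le_trans (fC x y z))//; suff -> : C * `|x| * `|y| * `|z| =
  C * `|z| * `|y| * `|x| by [].
by rewrite -!mulrA; congr (_ * _); rewrite mulrA [LHS]mulrC (mulrC `|x|).
Qed.

Definition flip3 : bounded_trilinear Z Y X W :=
  @BoundedTrilinear Z Y X W (fun z y x => f x y z)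
    (fun y x => trilin_linear3 f x y) (fun z x => trilin_linear2 f x z)
    (fun z y => trilin_linear1 f y z) flip3_bounded.

End Flip3.

Section Adjoint3.
Variables (X Y Z W : normedModType K) (f : bounded_trilinear X Y Z W).

Fact adj3_dual (w : dual W) x y : bounded_linearb (fun z => w (f x y z)).
Proof.
apply/asboolP; split=> [a z z'|]; first by rewrite trilin_linear3 dual_linear.
have [C C0 fC] := trilin_bounded_ge0 f.
exists (`|w| * (C * `|x| * `|y|)) => z.
by rewrite (le_trans (ler_dual _ _))// -[leRHS]mulrA ler_wpM2l.
Qed.

Definition adj3_fun (w : dual W) x y : dual Z := Dual (adj3_dual w x y).

Fact adj3_linear1 x y : linear (fun w => adj3_fun w x y).
Proof. by move=> a v w; apply: dual_ext. Qed.

Fact adj3_linear2 w y : linear (fun x => adj3_fun w x y).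
Proof.
move=> a x x'; apply: dual_ext => z /=.
by rewrite (trilin_linear1 f y z) dual_linear.
Qed.

Fact adj3_linear3 w x : linear (fun y => adj3_fun w x y).
Proof.
move=> a y y'; apply: dual_ext => z /=.
by rewrite (trilin_linear2 f x z) dual_linear.
Qed.

Fact adj3_bounded : exists C : K,
  forall w x y, `|adj3_fun w x y| <= C * `|w| * `|x| * `|y|.
Proof.
have [C C0 fC] := trilin_bounded_ge0 f; exists C => w x y.
apply: opnorm_le => [|z]; first by rewrite !mulr_ge0.
rewrite /= (le_trans (ler_dual _ _))// (mulrC C) -!mulrA ler_wpM2l//.
by rewrite !mulrA.
Qed.

Definition adj3 : bounded_trilinear (dual W) X Y (dual Z) :=
  BoundedTrilinear adj3_linear1 adj3_linear2 adj3_linear3 adj3_bounded.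

Lemma adj3E w x y z : adj3 w x y z = w (f x y z). Proof. by []. Qed.

End Adjoint3.

Definition adj3_4 X Y Z W (f : bounded_trilinear X Y Z W) :
    bounded_trilinear (bidual X) (bidual Y) (bidual Z) (bidual W) :=
  adj3 (adj3 (adj3 (adj3 f))).

Definition regular X Y Z W (f : bounded_trilinear X Y Z W) :=
  forall (x : bidual X) (y : bidual Y) (z : bidual Z),
    adj3_4 f x y z = flip3 (adj3_4 (flip3 f)) x y z.

End Multilinear.

Section BanachAlgebra.
Context {K : scalars}.

(* No unit is assumed. *)
Definition banach_algebra (A : completeNormedModType K)
    (m : bounded_bilinear A A A) :=
  (forall a b c, m a (m b c) = m (m a b) c) /\
  (forall a b, `|m a b| <= `|a| * `|b|).

Definition directed (I : Type) (le : I -> I -> Prop) :=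
  [/\ inhabited I, forall i, le i i,
      forall i j k, le i j -> le j k -> le i k
    & forall i j, exists k, le i k /\ le j k].

Definition tails (I : Type) (le : I -> I -> Prop) : set_system I :=
  [set S | exists i, forall j, le i j -> S j].

Variables (A : normedModType K) (m : bounded_bilinear A A A).

(* "Right" means that a e_i --> a, "left" that e_i a --> a. *)
Definition has_bounded_right_approximate_identity :=
  exists (I : Type) (le : I -> I -> Prop) (e : I -> A),
    [/\ directed le, exists C : K, forall i, `|e i| <= C
      & forall a, m a (e i) @[i --> tails le] --> a].

Definition has_bounded_left_approximate_identity :=
  exists (I : Type) (le : I -> I -> Prop) (e : I -> A),
    [/\ directed le, exists C : K, forall i, `|e i| <= C
      & forall a, m (e i) a @[i --> tails le] --> a].

End BanachAlgebra.

(* Main.v *)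
Require Import Defs.
From mathcomp Require Import all_boot all_order all_algebra.
From mathcomp Require Import all_classical all_reals all_analysis.
From mathcomp Require Import complex ring.

(** The approximate identity turns the weak compactness of the maps T into weak
compactness of a canonical map, and this forces the dual of A to be reflexive.
Reflexivity makes every bounded trilinear map on A regular.

Let E in the bidual be a limit, along an ultrafilter, of a bounded approximate
identity (e_i). If a e_i tends to a, then E(b |-> f(a b)) = f(a) for every f,
which says that T is the identity of A* for a** = E. If e_i a tends to a, then
E(b |-> f(b a)) = f(a), which says that T is the canonical embedding
J : A -> A** for a** = E ([bounded_net_bidual]).

By half of Gantmacher's theorem, the second adjoint of a weakly compact
S : X -> Y has its values in Y ([weakly_compact_bidual]). For S the identity of
A* it says that A* is reflexive. For S = J it gives for each x in A** some y in
A** with h(y) = x(h o J) for all h in A***; testing on the functionals coming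
from A* shows y = x. In both cases h(x) = x(h o J) for all h in A*** and x in
A**: this is [dual_reflexive].

The two extensions of a trilinear f are the iterated functionals
x(a |-> y(b |-> z(c |-> w(f(a,b,c))))) and
z(c |-> y(b |-> x(a |-> w(f(a,b,c))))). The second one is a bounded functional
of x, and also of y. Reflexivity of the duals therefore allows x, and then y, to
be moved to the outside, which yields the first one
([dual_reflexive_regular]).

Gantmacher's theorem rests on Goldstine's lemma: on finitely many functionals, x
in the unit ball of the bidual is approximated by points of the unit ball
([goldstine]). It is proved without the Hahn-Banach theorem. A near-minimiser a
of the Euclidean distance between the tuples (f(a)) and (x(f)) gives the
functional g = sum of conj(x(f) - f(a)) f; minimality bounds Re g on the ball,
hence the norm of g, by nearly Re g(a), whereas Re x(g) - Re g(a) is the squared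
distance. *)

Set Implicit Arguments.
Unset Strict Implicit.
Unset Printing Implicit Defensive.

Import Order.TTheory GRing.Theory Num.Theory.
Import numFieldNormedType.Exports.

Local Open Scope classical_set_scope.
Local Open Scope ring_scope.

(** * Conjugation and real part, for both kinds of scalars *)

Definition conj_scalar (K : scalars) : K -> K :=
  match K with
  | RealScalars R => fun z : R => z
  | ComplexScalars R => fun z : R[i] => z^*
  end.

Definition re_scalar (K : scalars) : K -> K :=
  match K with
  | RealScalars R => fun z : R => z
  | ComplexScalars R => fun z : R[i] => 'Re z
  end.

Section ScalarConjugation.
Variable K : scalars.
Implicit Types u z t : K.

Lemma conj_scalarK u : conj_scalar u * u = `|u| ^+ 2.
Proof.
case: K u => R u /=; first by rewrite -expr2 real_normK// num_real.
by rewrite normCK mulrC.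
Qed.

Lemma re_scalarB u z : re_scalar (u - z) = re_scalar u - re_scalar z.
Proof. by case: K u z => R u z //=; rewrite raddfB. Qed.

Lemma re_scalar_sum (I : Type) (s : seq I) (F : I -> K) :
  re_scalar (\sum_(i <- s) F i) = \sum_(i <- s) re_scalar (F i).
Proof. by case: K F => R F; rewrite //= raddf_sum. Qed.

Lemma re_scalar_ge0 u : 0 <= u -> re_scalar u = u.
Proof. by case: K u => R u //= u0; apply/Creal_ReP/ger0_real. Qed.

Lemma re_scalar_le u : re_scalar u <= `|u|.
Proof.
by case: K u => R u /=; [exact: ler_norm | have [] := leif_Re_Creal u].
Qed.

Lemma sqr_normB_scale t u z : t \is Num.real ->
  `|u - t * z| ^+ 2 =
  `|u| ^+ 2 - t * re_scalar (conj_scalar u * z) *+ 2 + t ^+ 2 * `|z| ^+ 2.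
Proof.
case: K t u z => R t u z treal /=.
  by rewrite !real_normK ?num_real//; ring.
have complexE (C : numClosedFieldType) (r v w : C) : r \is Num.real ->
    `|v - r * w| ^+ 2 =
    `|v| ^+ 2 - r * 'Re (v^* * w) *+ 2 + r ^+ 2 * `|w| ^+ 2.
  move=> rreal; rewrite !normCK rmorphB rmorphM /= (conj_Creal rreal) ReE.
  rewrite [(_ * w)^* ]rmorphM /= conjCK -mulr_natr -(mulrA r).
  by rewrite divfK ?pnatr_eq0//; ring.
exact: complexE.
Qed.

End ScalarConjugation.

(** * Goldstine's lemma *)

Section Goldstine.
Variables (K : scalars) (X : normedModType K).
Implicit Types (f g : dual X) (x : bidual X) (a b : X) (s : seq (dual X)).

Lemma dualD f a b : f (a + b) = f a + f b.
Proof. by have := dual_linear f 1 a b; rewrite !scale1r. Qed.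

Lemma dualB f a b : f (a - b) = f a - f b.
Proof. by rewrite dualD -scaleN1r dualZ mulN1r. Qed.

Lemma sum_dualE s (c : dual X -> K) a :
  (\sum_(f <- s) c f *: f) a = \sum_(f <- s) c f * f a.
Proof. by elim/big_rec2: _ => // f u v _ <-. Qed.

Lemma bidual_sum x s (c : dual X -> K) :
  x (\sum_(f <- s) c f *: f) = \sum_(f <- s) c f * x f.
Proof.
elim/big_rec2: _ => [|f u v _ <-]; first exact: dual0.
exact: (dual_linear x).
Qed.

(** Rotating b by a unimodular scalar makes g b equal to its modulus, so that
the real part alone controls the norm. *)
Lemma norm_dual_le_re g (M : K) :
  (forall b, `|b| <= 1 -> re_scalar (g b) <= M) -> `|g| <= M.
Proof.
move=> gM; have [_] := opnorm_supremums g; apply => _ [b /= b1 <-].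
have [gb0|gb0] := eqVneq (g b) 0.
  by have := gM b b1; rewrite gb0 normr0 re_scalar_ge0.
rewrite -(re_scalar_ge0 (normr_ge0 (g b))).
have -> : `|g b| = g ((`|g b| / g b) *: b) by rewrite dualZ divfK.
by apply: gM; rewrite normrZ normrM normr_id normfV divff ?normr_eq0// mul1r.
Qed.

(** If no point of the ball is within 1 of x on s, the squared distance [dist]
has a positive infimum d over the ball. Moving from a near-minimiser a towards
any b in the ball by a small parameter t cannot decrease [dist] by more than the
error of a, whence a bound on Re g b - Re g a of order t; for t small this
contradicts d <= dist a = Re (x g - g a). The precision 1 is general, since the
functionals in s may be rescaled. *)
Lemma goldstine x s : `|x| <= 1 ->
  exists2 a, `|a| <= 1 & forall f, f \in s -> `|f a - x f| < 1.
Proof.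
move=> x1; apply: contrapT => far.
pose dist a := \sum_(f <- s) `|x f - f a| ^+ 2.
pose diam := \sum_(f <- s) (`|f| * 2) ^+ 2.
have diam0 : 0 <= diam by apply: sumr_ge0 => f _; rewrite exprn_ge0// mulr_ge0.
have dist0 a : 0 <= dist a by apply: sumr_ge0 => f _; rewrite exprn_ge0.
have dist1 a : `|a| <= 1 -> 1 <= dist a.
  move=> a1; apply: contra_notT far => lt1; exists a => // f fs.
  rewrite real_ltNge ?ger0_real//; apply: contra lt1 => le1.
  rewrite /dist (big_rem f)//= -[leLHS]addr0 lerD//.
    by rewrite distrC exprn_ege1.
  by apply: sumr_ge0 => h _; rewrite exprn_ge0.
(* The infimum of dist over the ball, as the supremum of its lower bounds. *)
pose L := [set d : K | 0 <= d /\ forall a, `|a| <= 1 -> d <= dist a].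
have /supremums_nneg : L !=set0 by exists 1; split.
case=> [d []//||d [Lub Lle]].
  by exists (dist 0) => d [_]; apply; rewrite normr0.
have d1 : 1 <= d by apply: Lub; split.
have d0 : 0 < d by rewrite (lt_le_trans _ d1).
have dP a : `|a| <= 1 -> d <= dist a by move=> a1; apply: Lle => e [_]; exact.
have near e : 0 < e -> exists2 a, `|a| <= 1 & dist a < d + e.
  move=> e0; apply: contrapT => nea; have : d + e <= d; last first.
    by rewrite gerDl => /(lt_le_trans e0); rewrite ltxx.
  apply: Lub; split=> [|a a1]; first by rewrite addr_ge0// ltW.
  rewrite real_leNgt ?ger0_real// ?addr_ge0 ?ltW//.
  by apply/negP => lte; apply: nea; exists a.
(* The step t is chosen so that the error t (1 + diam) stays below d. *)
have [t [t0 t1 td]] : exists t, [/\ 0 < t, t <= 1 & t * (1 + diam) < d].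
  have D0 : 0 < 1 + diam + d by rewrite ltr_wpDr ?ltr_pwDl// ltW.
  exists (d / (1 + diam + d)); split; first by rewrite divr_gt0.
    by rewrite ler_pdivrMr// mul1r lerDr addr_ge0.
  by rewrite mulrAC ltr_pdivrMr// ltr_pM2l// ltrDl.
have [a a1 da] := near (t ^+ 2) (exprn_gt0 _ t0).
(* The derivative of dist at a in a direction p is -2 Re (g p). *)
pose g := \sum_(f <- s) conj_scalar (x f - f a) *: f.
have gE b : g b = \sum_(f <- s) conj_scalar (x f - f a) * f b.
  exact: sum_dualE.
have step b : `|b| <= 1 -> re_scalar (g b) <= re_scalar (g a) + t * (1 + diam).
  move=> b1; rewrite -lerBlDl -re_scalarB -dualB.
  have t1' : 0 <= 1 - t by rewrite subr_ge0.
  have mid1 : `|a + t *: (b - a)| <= 1.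
    have -> : a + t *: (b - a) = (1 - t) *: a + t *: b.
      by rewrite scalerBr scalerBl scale1r addrA addrAC.
    rewrite (le_trans (ler_normD _ _))// !normrZ.
    rewrite (gtr0_norm t0) (ger0_norm t1').
    by rewrite -[leRHS](subrK t) lerD// ler_piMr// ltW.
  have := dP _ mid1.
  have -> : dist (a + t *: (b - a)) = dist a
      - t * re_scalar (g (b - a)) *+ 2
      + t ^+ 2 * \sum_(f <- s) `|f (b - a)| ^+ 2.
    rewrite gE re_scalar_sum mulr_sumr -sumrMnl mulr_sumr /dist -sumrB.
    rewrite -big_split /=; apply: eq_bigr => f _.
    by rewrite (dualD f a) (dualZ f) opprD addrA sqr_normB_scale// gtr0_real.
  have Mle : \sum_(f <- s) `|f (b - a)| ^+ 2 <= diam.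
    apply: ler_sum => f _; rewrite ler_sqr ?nnegrE ?mulr_ge0//.
    rewrite (le_trans (ler_dual _ _))// ler_wpM2l//.
    by rewrite (le_trans (ler_normB _ _))// -[2]/(1 + 1) lerD.
  rewrite addrAC lerBrDr -lerBrDl => stepD.
  have ge0t := ltW t0.
  have bound0 : 0 <= t * (t * (1 + diam)) by rewrite !mulr_ge0// addr_ge0.
  rewrite -(ler_pM2l t0) -(ler_pMn2r (isT : (0 < 2)%N)).
  rewrite (le_trans stepD)// mulr2n ler_wpDl//.
  rewrite mulrA -expr2 mulrDr mulr1 addrAC lerD//.
    by rewrite lerBlDl ltW.
  by rewrite ler_wpM2l// exprn_ge0// ltW.
have /norm_dual_le_re gle := step.
have dgap : dist a <= t * (1 + diam).
  have -> : dist a = re_scalar (x g - g a).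
    rewrite bidual_sum gE -sumrB re_scalar_ge0.
      by apply: eq_bigr => f _; rewrite -mulrBr conj_scalarK.
    by apply: sumr_ge0 => f _; rewrite -mulrBr conj_scalarK exprn_ge0.
  rewrite re_scalarB lerBlDl; apply: le_trans gle.
  rewrite (le_trans (re_scalar_le _))// (le_trans (ler_dual _ _))//.
  by rewrite ler_piMl.
by have := lt_le_trans td (le_trans (dP _ a1) dgap); rewrite ltxx.
Qed.

End Goldstine.

(** * Weakly compact maps and biduals *)

Section Gantmacher.
Variables (K : scalars) (X Y : normedModType K) (T : X -> Y).

(** Goldstine's lemma gives a filter F on the ball of X converging to x in the
weak-star topology. Its image by T lives in a weakly compact set, hence has a
weak cluster point y, and along F the values h (T a) = g a tend to x g. *)
Lemma weakly_compact_unit_bidual (x : bidual X) :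
  weakly_compact T -> `|x| <= 1 ->
  exists y : Y, forall (h : dual Y) (g : dual X),
    (forall a, g a = h (T a)) -> h y = x g.
Proof.
move=> wcT x1.
pose V (s : seq (dual X)) :=
  [set a : X | `|a| <= 1 /\ forall f, f \in s -> `|f a - x f| < 1].
pose F := filter_from setT V.
have FF : ProperFilter F.
  apply: filter_from_proper => [|s _]; last first.
    by have [a a1 sa] := goldstine s x1; exists a.
  apply: filter_fromT_filter; first by exists [::].
  move=> s1 s2; exists (s1 ++ s2) => a [a1 sa].
  by split; split=> // f fs; apply: sa; rewrite mem_cat fs ?orbT.
have Fball : F [set a : X | `|a| <= 1] by exists [::] => // a [].
have Fcvg (g : dual X) (e : K) : 0 < e -> F [set a | `|g a - x g| < e].
  move=> e0; exists [:: e^-1 *: g] => // a [_ /(_ _ (mem_head _ _))].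
  have -> : x (e^-1 *: g) = e^-1 * x g by exact: dualZ.
  rewrite dualZE -mulrBr normrM gtr0_norm ?invr_gt0//.
  by rewrite ltr_pdivrMl// mulr1.
have [y [_ yF]] : closure (T @` [set a | `|a| <= 1] : set (weak Y)) `&`
    cluster ((T : X -> weak Y) @ F) !=set0.
  apply: wcT; apply: (filterS (@subset_closure (weak Y) _)).
  by rewrite /= /nbhs/=; apply: filterS Fball => a a1; exists a.
exists y => h g gT; apply/eqP; rewrite -subr_eq0 -normr_le0.
apply: contrapT => /negP.
rewrite normr_le0 -normr_gt0 => hy0.
pose e := `|h y - x g| / 2.
have e0 : 0 < e by rewrite divr_gt0.
have cvh := (@weak_cvgP K Y (nbhs (y : weak Y)) y (@nbhs_filter (weak Y) y)).1
  (fun _ => id) h.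
have nearT : nbhs (y : weak Y) [set z | `|h y - h z| < e].
  exact: ((@cvgrPdist_lt _ _ _ _ (@nbhs_filter (weak Y) y) _ _).1 cvh).
have Fh : ((T : X -> weak Y) @ F) [set z | `|h z - x g| < e].
  by apply: filterS (Fcvg g e e0) => a /=; rewrite gT.
have [z [/= hz1 hz2]] := yF _ _ Fh nearT.
have : `|h y - x g| < e + e.
  by rewrite -(subrKA (h z)) (le_lt_trans (ler_normD _ _))// ltrD.
by rewrite -splitr ltxx.
Qed.

Lemma weakly_compact_bidual (x : bidual X) : weakly_compact T ->
  exists y : Y, forall (h : dual Y) (g : dual X),
    (forall a, g a = h (T a)) -> h y = x g.
Proof.
move=> wcT; have [->|x0] := eqVneq x 0.
  by exists 0 => h g _; rewrite dual0.
have [|y yP] := @weakly_compact_unit_bidual (`|x|^-1 *: x) wcT.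
  by rewrite normrZ normfV normr_id mulVf ?normr_eq0.
exists (`|x| *: y) => h g gT; rewrite dualZ (yP _ _ gT) dualZE mulrA.
by rewrite divff ?normr_eq0// mul1r.
Qed.

End Gantmacher.

(** * Reflexivity of the dual *)

Section CanonicalEmbedding.
Variables (K : scalars) (X : normedModType K).

Fact eval_bounded_linear (a : X) :
  bounded_linearb (fun f : dual X => (f a : K^o)).
Proof.
apply/asboolP; split=> [//|]; exists `|a| => f.
by rewrite mulrC ler_dual.
Qed.

Definition canonical_embedding (a : X) : bidual X :=
  Dual (eval_bounded_linear a).

End CanonicalEmbedding.

(** Reflexivity of the dual of X: each h in X*** is the evaluation at an element
of X*, which can only be h o J, where J is the canonical embedding of X. Here g
stands for h o J; leaving it as a variable spares its construction. *)
Definition dual_reflexive (K : scalars) (X : normedModType K) :=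
  forall (h : dual (bidual X)) (x : bidual X) (g : dual X),
    (forall a, g a = h (canonical_embedding a)) -> h x = x g.

(** The element y given by x satisfies h y = x (h o J) for all h; if h is the
evaluation at some f in X*, this reads y f = x f. *)
Lemma dual_reflexive_of_embedding (K : scalars) (X : normedModType K) :
  weakly_compact (@canonical_embedding K X) -> dual_reflexive X.
Proof.
move=> wc h x g gh; have [y yP] := weakly_compact_bidual x wc.
suff yx : y = x by rewrite -(yP h g gh) yx.
by apply: dual_ext => f; exact: (yP (canonical_embedding f) f).
Qed.

(** Here it is h, an element of the bidual of X*, that comes from some y in X*;
on the evaluations at points of X one finds y = g. *)
Lemma dual_reflexive_of_dual_id (K : scalars) (X : normedModType K) :
  weakly_compact (@id (dual X)) -> dual_reflexive X.
Proof.
move=> wc h x g gh; have [y yP] := weakly_compact_bidual h wc.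
have -> : g = y.
  apply: dual_ext => a.
  by rewrite gh -(yP (canonical_embedding a) _ (fun=> erefl)).
by rewrite (yP x x).
Qed.

(** * Regularity of trilinear maps *)

Section Regularity.
Variables (K : scalars) (X Y Z W : normedModType K).
Implicit Types f : bounded_trilinear X Y Z W.

(** G is the extension in which the functional x is innermost. As functions of
x, and then of y, its values are bounded functionals, obtained as adjoints of G;
reflexivity replaces x, then y, by variables a in X and b in Y, and applies x
and y last. What remains innermost is z, as in the other extension. *)
Lemma dual_reflexive_regular f :
  dual_reflexive X -> dual_reflexive Y -> regular f.
Proof.
move=> reflX reflY x y z; apply: dual_ext => w.
pose G := flip3 (adj3_4 (flip3 f)).
(* Gx is x' |-> G x' y z w. The adjoint expects a functional on the bidual of W
   where w is wanted, hence the evaluation at w; likewise below for J a. *)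
pose Gx := adj3 (flip3 G) (canonical_embedding w) z y.
rewrite -[RHS]/(Gx x) (reflX Gx x (adj3 (adj3 (adj3 f)) y z w))// => a.
(* Gy is y' |-> G (J a) y' z w. *)
pose Gy := adj3 (adj3 (flip3 G)) (canonical_embedding (canonical_embedding a))
  (canonical_embedding w) z.
rewrite -[RHS]/(Gy y) (reflY Gy y (adj3 (adj3 f) z w a))// => b.
by congr (z _); exact: dual_ext.
Qed.

End Regularity.

(** * Limits of bounded nets in the bidual *)

Section BoundedNets.
Variables (I : Type) (U : set_system I).
Context (UU : UltraFilter U).

Lemma ultra_cvg_compact (S : topologicalType) (A : set S) (v : I -> S) :
  compact A -> (forall i, A (v i)) -> exists l : S, v @ U --> l.
Proof.
move=> cA Av; have [|l [_ lU]] := cA (v @ U) _.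
  exact: (@filterS _ U _ setT (v @^-1` A) (fun i _ => Av i) filterT).
exists l => B /= Bl; have [//|UB] := in_ultra_setVsetC (v @^-1` B) UU.
by have [z []] := lU (~` B) B UB Bl.
Qed.

Lemma real_bounded_ultra_cvg (R : realType) (v : I -> R) (M : R) :
  (forall i, `|v i| <= M) -> exists l : R, v @ U --> l.
Proof.
move=> vM; apply: (ultra_cvg_compact (@segment_compact R (- M) M)) => i.
by rewrite /= in_itv/= -ler_norml.
Qed.

Lemma complex_bounded_ultra_cvg (R : realType) (v : I -> R[i]^o) (M : R[i]) :
  (forall i, `|v i| <= M) -> exists l : R[i]^o, v @ U --> l.
Proof.
move=> vM.
have partM (p : R[i] -> R) : (forall z, `|p z| <= complex.Re `|z|) ->
    exists l : R, p \o v @ U --> l.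
  move=> pz; apply: (@real_bounded_ultra_cvg R _ (complex.Re M)) => i.
  by rewrite (le_trans (pz _))//; have := vM i; rewrite lecE => /andP[].
have [z|a va] := partM (@complex.Re R).
  by rewrite normc_def /= -[leLHS]sqrtr_sqr ler_wsqrtr// lerDl sqr_ge0.
have [z|b vb] := partM (@complex.Im R).
  by rewrite normc_def /= -[leLHS]sqrtr_sqr ler_wsqrtr// lerDr sqr_ge0.
exists (Complex a b : R[i]^o); apply/cvgrPdist_lt => -[e e'].
rewrite ltcE /= => /andP[/eqP -> e0].
have e2 : 0 < e / 2 by rewrite divr_gt0.
have near_a : \forall i \near U, `|a - complex.Re (v i)| < e / 2.
  by move/cvgrPdist_lt : va; exact.
have near_b : \forall i \near U, `|b - complex.Im (v i)| < e / 2.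
  by move/cvgrPdist_lt : vb; exact.
near=> i.
have : `|a - complex.Re (v i)| < e / 2 by near: i; exact: near_a.
have : `|b - complex.Im (v i)| < e / 2 by near: i; exact: near_b.
case: (v i) => c d /= bd ac.
rewrite normc_def /= ltcR (le_lt_trans (_ : _ <= `|a - c| + `|b - d|))//.
  rewrite -[leRHS]ger0_norm ?addr_ge0// -[leRHS]sqrtr_sqr ler_wsqrtr//.
  rewrite [leRHS]sqrrD !real_normK ?num_real// addrAC lerDl.
  by rewrite mulrn_wge0// mulr_ge0.
by rewrite (splitr e) ltrD.
Unshelve. all: by end_near.
Qed.

Lemma scalar_bounded_ultra_cvg (K : scalars) (u : I -> K^o) (C : K) :
  (forall i, `|u i| <= C) -> exists l : K^o, u @ U --> l.
Proof.
case: K u C => R u C uC; first exact: real_bounded_ultra_cvg uC.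
exact: complex_bounded_ultra_cvg uC.
Qed.

End BoundedNets.

(** The Banach-Alaoglu theorem for one ultrafilter: the pointwise limits of
f (e i) exist since bounded sets of scalars are relatively compact, and they
depend linearly on f. *)
Lemma bounded_ultra_bidual (K : scalars) (X : normedModType K) (I : Type)
    (U : set_system I) (e : I -> X) (C : K) :
  UltraFilter U -> (forall i, `|e i| <= C) ->
  exists x : bidual X, forall f : dual X, f \o e @ U --> x f.
Proof.
move=> UU eC.
have C0 : 0 <= C.
  by have [i _] := filter_ex (@filterT _ U _); rewrite (le_trans _ (eC i)).
have fC (f : dual X) i : `|f (e i)| <= `|f| * C.
  by rewrite (le_trans (ler_dual _ _))// ler_wpM2l.
have lim (f : dual X) : {l : K^o | f \o e @ U --> l}.
  by apply: cid; exact: (scalar_bounded_ultra_cvg UU (fC f)).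
have limL : bounded_linear (fun f : dual X => sval (lim f)).
  split=> [k f g|]; last first.
    exists C => f; case: (lim f) => l /= fl.
    rewrite real_leNgt ?ger0_real// ?mulr_ge0//; apply/negP => lt_l.
    have gap0 : 0 < `|l| - C * `|f| by rewrite subr_gt0.
    have near_l : \forall i \near U, `|l - f (e i)| < `|l| - C * `|f|.
      by move/cvgrPdist_lt : fl; exact.
    have [i lt_i] := filter_ex near_l.
    move: lt_i; rewrite ltrBrDr => /(le_lt_trans _) lt_i.
    have := lt_i `|l|; rewrite ltxx => /(_ _)/notF; apply.
    rewrite -{1}(subrK (f (e i)) l) (le_trans (ler_normD _ _))// lerD2l.
    by rewrite mulrC fC.
  case: (lim f) => l fl; case: (lim g) => m gm; case: (lim _) => n /= fgn.
  apply: (@norm_cvg_unique _ K^o _ _ _ _ fgn).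
  have kfl : (k *: (f (e i) : K^o)) @[i --> U] --> k *: l by exact: cvgZl_tmp.
  exact: (cvgD kfl gm).
exists (Dual (introT (asboolP _) limL)) => f /=.
by case: (lim f).
Qed.

Lemma tails_proper (I : Type) (le : I -> I -> Prop) :
  directed le -> ProperFilter (tails le).
Proof.
move=> [[i0] lexx letr lejoin].
have TF : Filter (tails le).
  split; first by exists i0.
    move=> P Q [i Pi] [j Qj]; have [k [ik jk]] := lejoin i j.
    by exists k => l kl; split; [apply: Pi|apply: Qj]; exact: letr kl.
  by move=> P Q PQ [i Pi]; exists i => j ij; exact/PQ/Pi.
by split=> //; case=> i /(_ _ (lexx i)).
Qed.

(** Along an ultrafilter finer than the tails of the net, e converges weak-star
to some x, and every limit that exists along the net itself is preserved. *)
Lemma bounded_net_bidual (K : scalars) (X : normedModType K) (I : Type)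
    (le : I -> I -> Prop) (e : I -> X) (C : K) :
  directed le -> (forall i, `|e i| <= C) ->
  exists x : bidual X, forall (f : dual X) (l : K^o),
    f \o e @ tails le --> l -> x f = l.
Proof.
move=> /tails_proper PT eC; have [U [UU leU]] := ultraFilterLemma PT.
have [x xU] := bounded_ultra_bidual UU eC.
exists x => f l fl; apply: (@norm_cvg_unique _ K^o _ _ _ _ (xU f)).
by apply: cvg_trans fl => B /=; exact: leU.
Qed.

Lemma dual_cvg (K : scalars) (X : normedModType K) (I : Type)
    (F : set_system I) (u : I -> X) (a : X) (f : dual X) :
  Filter F -> u @ F --> a -> f \o u @ F --> (f a : K^o).
Proof.
move=> FF /cvgrPdist_lt ua; apply/cvgrPdist_lt => eps eps0.
have D0 : 0 < `|f| + 1 by rewrite ltr_wpDl.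
have near_a : \forall i \near F, `|a - u i| < eps / (`|f| + 1).
  by apply: ua; rewrite divr_gt0.
apply: filterS near_a => i; rewrite ltr_pdivlMr// => lt_i.
rewrite /= -dualB (le_lt_trans (ler_dual _ _))// (le_lt_trans _ lt_i)//.
by rewrite mulrC ler_wpM2l// lerDl.
Qed.

(** * Regularity over algebras with an approximate identity *)

Theorem theorem5 (K : scalars) (A : completeNormedModType K)
    (pi : bounded_bilinear A A A) (hA : banach_algebra pi)
    (Omega : bounded_trilinear A A A A) :
  (has_bounded_right_approximate_identity pi ->
   (forall a : bidual A,
      weakly_compact (fun f : dual A => adj2 (adj2 pi) a f)) ->
   regular Omega) /\
  (has_bounded_left_approximate_identity pi ->
   (forall a : bidual A,
      weakly_compact (fun b : A => adj2 (flip2 (adj2 (flip2 pi))) a b)) ->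
   regular Omega).
Proof.
split=> -[I [le [e [dir [C eC] ecvg]]]] wc;
  have [E limE] := bounded_net_bidual dir eC; have := tails_proper dir => PT.
  suff reflA : dual_reflexive A by exact: dual_reflexive_regular.
  apply: dual_reflexive_of_dual_id.
  suff <- : (fun f : dual A => adj2 (adj2 pi) E f) = id by exact: wc.
  apply/funext => f; apply: dual_ext => a; apply: limE.
  exact: (dual_cvg _ (ecvg a)).
suff reflA : dual_reflexive A by exact: dual_reflexive_regular.
apply: dual_reflexive_of_embedding.
suff <- : (fun b : A => adj2 (flip2 (adj2 (flip2 pi))) E b) =
  @canonical_embedding K A by exact: wc.
apply/funext => b; apply: dual_ext => f; apply: limE.
exact: (dual_cvg _ (ecvg b)).
Qed.
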